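(* Let $(X,x)$ be a locally path connected pointed space and let $\mathcal{V}=\{V_{\alpha}\mid\alpha\in P(X,x)\}$ be a path open cover of $(X,x)$. Then $\widetilde{\pi}(\mathcal{V},x)$ is an open subgroup of $\pi_1^{qtop}(X,x)$.
   Context: $P(X,x)$ is the set of all paths $\alpha:[0,1]\to X$ with $\alpha(0)=x$. A path open cover of a pointed space $(X,x)$ is an open cover $\mathcal{V}=\{V_{\alpha}\mid\alpha\in P(X,x)\}$ of $X$, indexed by $P(X,x)$, such that $\alpha(1)\in V_{\alpha}$ for every $\alpha\in P(X,x)$. The path Spanier group $\widetilde{\pi}(\mathcal{V},x)$ with respect to the path open cover $\mathcal{V}$ is the subgroup of $\pi_1(X,x)$ consisting of all homotopy classes having a representative of the form $\prod_{j=1}^{n}u_jv_ju_j^{-1}$, where each $u_j$ is an arbitrary path starting at $x$ and each $v_j$ is a loop based at $u_j(1)$ lying inside $V_{u_j}$. The quasitopological fundamental group $\pi_1^{qtop}(X,x)$ is the group $\pi_1(X,x)$ with the quotient topology induced by the map $q:\Omega(X,x)\to\pi_1(X,x)$, $q(\gamma)=[\gamma]$, where $\Omega(X,x)$ is the space of loops in $X$ based at $x$ with the compact-open topology. *)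

(* Defs.v *)
From HB Require Import structures.
From mathcomp Require Import all_boot all_order all_algebra generic_quotient.
From mathcomp Require Import all_classical all_reals all_analysis homotopy.
From mathcomp Require Import lra.

Set Implicit Arguments.
Unset Strict Implicit.
Unset Printing Implicit Defensive.

Import Order.TTheory GRing.Theory Num.Theory.
Import numFieldNormedType.Exports.

Local Open Scope classical_set_scope.
Local Open Scope ring_scope.
Local Open Scope quotient_scope.

Lemma comp_continuous {S T U : topologicalType} (f : S -> T) (g : T -> U) :
  continuous f -> continuous g -> continuous (fun s => g (f s)).
Proof. by move=> cf cg s; apply: continuous_comp; [exact: cf|exact: cg]. Qed.

Lemma fst_continuous {S T : topologicalType} : continuous (@fst S T).
Proof. by move=> z; exact: cvg_fst. Qed.

Lemma snd_continuous {S T : topologicalType} : continuous (@snd S T).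
Proof. by move=> z; exact: cvg_snd. Qed.

Lemma pair_continuous {S T U : topologicalType} (f : S -> T) (g : S -> U) :
  continuous f -> continuous g -> continuous (fun s => (f s, g s)).
Proof.
by move=> cf cg s; apply: (cvg_pair (FG := nbhs_filter _) (FH := nbhs_filter _));
  [exact: cf|exact: cg].
Qed.

Definition unit_interval (R : realType) : Type := `[0%R, 1%R]%classic : set R.

Section unit_interval.
Context {R : realType}.
Local Notation I := (unit_interval R).

HB.instance Definition _ := Topological.copy I (`[0%R, 1%R]%classic : set R).

Definition ival (t : I) : R := set_val (t : (`[0%R, 1%R]%classic : set R)).

Lemma ival_itv (t : I) : 0 <= ival t <= 1.
Proof.
have := set_valP (t : (`[0%R, 1%R]%classic : set R)).
by rewrite /= in_itv.
Qed.

Lemma ival_inj : injective ival.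
Proof. exact: val_inj. Qed.

Lemma ival_continuous : continuous ival.
Proof. exact: initial_continuous. Qed.

Lemma clamp_in (r : R) : Num.max 0 (Num.min 1 r) \in `[0%R, 1%R]%classic.
Proof.
by rewrite inE /= in_itv /= le_max lexx /= ge_max ler01 /= ge_min lexx.
Qed.

(* The nearest-point retraction of R onto [0, 1]. It makes expressions such as
   2t - 1 total; where they are used below they already lie in [0, 1]. *)
Definition clamp (r : R) : I :=
  exist (fun s : R => s \in `[0%R, 1%R]%classic) _ (clamp_in r).

Lemma clampE (r : R) : 0 <= r <= 1 -> ival (clamp r) = r.
Proof.
case/andP=> r0 r1; rewrite /ival /= set_valE /=.
by rewrite min_r // max_r.
Qed.

Lemma clampK (t : I) : clamp (ival t) = t.
Proof. by apply: ival_inj; rewrite clampE // ival_itv. Qed.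

Lemma clamp_continuous : continuous clamp.
Proof.
apply/continuousP => _ [B oB <-].
have c : continuous (fun r : R => Num.max 0 (Num.min 1 r)).
  move=> r.
  apply: (@continuous_max _ _ (fun=> 0) (fun r : R => Num.min 1 r)).
    exact: cvg_cst.
  by apply: (@continuous_min _ _ (fun=> 1) id); [exact: cvg_cst|exact: cvg_id].
by move/continuousP: c => /(_ _ oB).
Qed.

Lemma unit_interval_neq : clamp 0 != clamp 1.
Proof.
apply/eqP => /(congr1 ival); rewrite !clampE ?lexx ?ler01 // => /eqP.
by rewrite eq_sym oner_eq0.
Qed.

HB.instance Definition _ := isBiPointed.Build I unit_interval_neq.

Lemma ival0 : ival (zero : I) = 0.
Proof. by rewrite clampE // lexx ler01. Qed.

Lemma ival1 : ival (one : I) = 1.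
Proof. by rewrite clampE // lexx ler01. Qed.

Lemma clamp0 : clamp 0 = zero. Proof. by []. Qed.

Lemma clamp1 : clamp 1 = one. Proof. by []. Qed.

Lemma if_le_continuous {S X : topologicalType} (a : S -> R) (c : R)
    (f g : S -> X) :
  continuous a -> continuous f -> continuous g ->
  (forall s, a s = c -> f s = g s) ->
  continuous (fun s => if a s <= c then f s else g s).
Proof.
move=> ca cf cg fg; apply/continuous_closedP => C clC.
have -> : (fun s => if a s <= c then f s else g s) @^-1` C =
    (a @^-1` [set r | r <= c] `&` f @^-1` C)
    `|` (a @^-1` [set r | c <= r] `&` g @^-1` C).
  apply/seteqP; split => s /=.
    by case: (leP (a s) c) => [? ?|/ltW ? ?]; [left|right].
  case: (ltgtP (a s) c) => // e; [by case=> -[]|by case=> -[]|].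
  by case=> -[] // _; rewrite fg.
move/continuous_closedP: ca => ca.
move/continuous_closedP: cf => cf.
move/continuous_closedP: cg => cg.
apply: closedU; apply: closedI; by [apply: ca|apply: cf|apply: cg].
Qed.

End unit_interval.

Notation upath R x y := {path unit_interval R from x to y}%type.

Section path_operations.
Context {R : realType} {X : topologicalType}.
Local Notation I := (unit_interval R).

Definition concat_fun (f g : I -> X) (t : I) : X :=
  if ival t <= 2^-1 then f (clamp (2 * ival t))
  else g (clamp (2 * ival t - 1)).

Definition inv_fun (f : I -> X) (t : I) : X := f (clamp (1 - ival t)).

Lemma maxr_continuous {S : topologicalType} (f g : S -> R) :
  continuous f -> continuous g -> continuous (fun s => Num.max (f s) (g s)).
Proof.
by move=> cf cg s; apply: (@continuous_max _ _ f g); [exact: cf|exact: cg].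
Qed.

Lemma minr_continuous {S : topologicalType} (f g : S -> R) :
  continuous f -> continuous g -> continuous (fun s => Num.min (f s) (g s)).
Proof.
by move=> cf cg s; apply: (@continuous_min _ _ f g); [exact: cf|exact: cg].
Qed.

Lemma constant_continuous {S T : topologicalType} (c : T) :
  continuous (fun _ : S => c).
Proof. by move=> s; exact: cvg_cst. Qed.

Lemma affine_real_continuous {S : topologicalType} (h : S -> R) (a b : R) :
  continuous h -> continuous (fun s => a * h s + b).
Proof.
move=> ch s; apply: cvgD; last exact: cvg_cst.
by apply: cvgM; [exact: cvg_cst|exact: ch].
Qed.

Lemma affine_continuous {S : topologicalType} (h : S -> R) (a b : R) :
  continuous h -> continuous (fun s => clamp (a * h s + b)).
Proof.
move=> ch; apply: (comp_continuous _ clamp_continuous).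
exact: affine_real_continuous.
Qed.

Lemma concat_continuous (f g : I -> X) :
  continuous f -> continuous g -> f one = g zero ->
  continuous (concat_fun f g).
Proof.
move=> cf cg fg; apply: (if_le_continuous ival_continuous) => [||t ->].
- apply: (comp_continuous _ cf).
  have := @affine_continuous _ ival 2 0 ival_continuous.
  by under eq_fun do rewrite addr0.
- exact/(comp_continuous _ cg)/affine_continuous/ival_continuous.
- by rewrite divff ?pnatr_eq0 // subrr clamp0 clamp1.
Qed.

Lemma inv_continuous (f : I -> X) : continuous f -> continuous (inv_fun f).
Proof.
move=> cf; apply: (comp_continuous _ cf).
have := @affine_continuous _ ival (-1) 1 ival_continuous.
by under eq_fun do rewrite mulN1r addrC.
Qed.

Section concat.
Context {x y z : X} (p : upath R x y) (q : upath R y z).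

Let cts : continuous (concat_fun p q).
Proof.
apply: concat_continuous; [exact: cts_fun|exact: cts_fun|].
by rewrite path_one path_zero.
Qed.

Let zeroE : concat_fun p q zero = x.
Proof. by rewrite /concat_fun ival0 invr_ge0 ler0n mulr0 clamp0 path_zero. Qed.

Let oneE : concat_fun p q one = z.
Proof.
rewrite /concat_fun ival1 ifF; last by apply/negbTE; rewrite -ltNge; lra.
by rewrite mulr1 (_ : 2 - 1 = 1 :> R) ?clamp1 ?path_one //; lra.
Qed.

Definition concat_path : upath R x z := mk_path cts zeroE oneE.

Lemma concat_pathE : concat_path = concat_fun p q :> (I -> X).
Proof. by []. Qed.
End concat.

Section inverse.
Context {x y : X} (p : upath R x y).

Let cts : continuous (inv_fun p).
Proof. by apply: inv_continuous; exact: cts_fun. Qed.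

Let zeroE : inv_fun p zero = y.
Proof. by rewrite /inv_fun ival0 subr0 clamp1 path_one. Qed.

Let oneE : inv_fun p one = x.
Proof. by rewrite /inv_fun ival1 subrr clamp0 path_zero. Qed.

Definition inv_path : upath R y x := mk_path cts zeroE oneE.

Lemma inv_pathE : inv_path = inv_fun p :> (I -> X).
Proof. by []. Qed.
End inverse.

Definition const_path (x : X) : upath R x x := cst x.

Definition path_homotopic {x y : X} (p q : upath R x y) : Prop :=
  exists H : (I * I)%type -> X,
    [/\ continuous H,
        forall t, H (t, zero) = p t,
        forall t, H (t, one) = q t,
        forall s, H (zero, s) = x &
        forall s, H (one, s) = y].

Section homotopic_equiv.
Context {x y : X}.
Implicit Types p q r : upath R x y.

Lemma path_homotopic_refl p : path_homotopic p p.
Proof.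
exists (fun z => p z.1); split=> [|t|t|s|s] //=.
- exact: (comp_continuous fst_continuous (@cts_fun _ _ p)).
- by rewrite path_zero.
- by rewrite path_one.
Qed.

Lemma path_homotopic_sym p q : path_homotopic p q -> path_homotopic q p.
Proof.
case=> H [cH H0 H1 Hz Ho].
exists (fun z => H (z.1, clamp (1 - ival z.2))); split=> [|t|t|s|s] //=.
- apply: (comp_continuous _ cH); apply: (pair_continuous fst_continuous).
  have := @affine_continuous _ (fun z : I * I => ival z.2) (-1) 1
    (comp_continuous snd_continuous ival_continuous).
  by under eq_fun do rewrite mulN1r addrC.
- by rewrite ival0 subr0 clamp1.
- by rewrite ival1 subrr clamp0.
Qed.

Lemma path_homotopic_trans p q r :
  path_homotopic p q -> path_homotopic q r -> path_homotopic p r.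
Proof.
case=> H [cH H0 H1 Hz Ho] [K [cK K0 K1 Kz Ko]].
have c2 : continuous (fun z : I * I => ival z.2).
  exact: (comp_continuous snd_continuous ival_continuous).
exists (fun z => if ival z.2 <= 2^-1 then H (z.1, clamp (2 * ival z.2 + 0))
  else K (z.1, clamp (2 * ival z.2 + -1))); split=> [|t|t|s|s] /=.
- apply: (if_le_continuous c2) => [||z ->].
  + apply: (comp_continuous _ cH); apply: (pair_continuous fst_continuous).
    exact: (affine_continuous c2).
  + apply: (comp_continuous _ cK); apply: (pair_continuous fst_continuous).
    exact: (affine_continuous c2).
  + by rewrite divff ?pnatr_eq0 // addr0 subrr clamp0 clamp1 H1 K0.
- by rewrite ival0 invr_ge0 ler0n mulr0 addr0 clamp0.
- rewrite ival1 ifF; last by apply/negbTE; rewrite -ltNge; lra.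
  by rewrite mulr1 (_ : 2 + -1 = 1 :> R) ?clamp1 //; lra.
- by case: ifP.
- by case: ifP.
Qed.

End homotopic_equiv.

Lemma concat_path_homotopic {x y z : X} (p p' : upath R x y)
    (q q' : upath R y z) :
  path_homotopic p p' -> path_homotopic q q' ->
  path_homotopic (concat_path p q) (concat_path p' q').
Proof.
case=> H [cH H0 H1 Hz Ho] [K [cK K0 K1 Kz Ko]].
have c1 : continuous (fun z : I * I => ival z.1).
  exact: (comp_continuous fst_continuous ival_continuous).
exists (fun z => if ival z.1 <= 2^-1 then H (clamp (2 * ival z.1 + 0), z.2)
  else K (clamp (2 * ival z.1 + -1), z.2)); split=> [|t|t|s|s] /=.
- apply: (if_le_continuous c1) => [||w ->].
  + apply: (comp_continuous _ cH); apply: (pair_continuous _ snd_continuous).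
    exact: (affine_continuous c1).
  + apply: (comp_continuous _ cK); apply: (pair_continuous _ snd_continuous).
    exact: (affine_continuous c1).
  + by rewrite divff ?pnatr_eq0 // addr0 subrr clamp0 clamp1 Ho Kz.
- by rewrite concat_pathE /concat_fun addr0 H0 K0.
- by rewrite concat_pathE /concat_fun addr0 H1 K1.
- by rewrite ival0 invr_ge0 ler0n mulr0 addr0 clamp0.
- rewrite ival1 ifF; last by apply/negbTE; rewrite -ltNge; lra.
  by rewrite mulr1 (_ : 2 + -1 = 1 :> R) ?clamp1 //; lra.
Qed.

Lemma inv_path_homotopic {x y : X} (p q : upath R x y) :
  path_homotopic p q -> path_homotopic (inv_path p) (inv_path q).
Proof.
case=> H [cH H0 H1 Hz Ho].
exists (fun z => H (clamp (1 - ival z.1), z.2)); split=> [|t|t|s|s] //=.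
- apply: (comp_continuous _ cH); apply: (pair_continuous _ snd_continuous).
  have := @affine_continuous _ (fun z : I * I => ival z.1) (-1) 1
    (comp_continuous fst_continuous ival_continuous).
  by under eq_fun do rewrite mulN1r addrC.
- by rewrite H0.
- by rewrite H1.
- by rewrite ival0 subr0 clamp1.
- by rewrite ival1 subrr clamp0.
Qed.

Lemma reparametrization_homotopic {a b x y : X} (f : upath R a b)
    (p q : upath R x y) (phi psi : I -> R) :
  continuous phi -> continuous psi ->
  phi zero = psi zero -> phi one = psi one ->
  (forall t, p t = f (clamp (phi t))) ->
  (forall t, q t = f (clamp (psi t))) ->
  path_homotopic p q.
Proof.
move=> cphi cpsi phi0 phi1 pE qE.
exists (fun z => f (clamp (phi z.1 + ival z.2 * (psi z.1 - phi z.1)))).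
split=> [|t|t|s|s] /=.
- apply: (comp_continuous _ (@cts_fun _ _ f)).
  apply: (comp_continuous _ clamp_continuous) => z.
  have cp : {for z, continuous (fun z : I * I => phi z.1)}.
    exact: (comp_continuous fst_continuous cphi).
  have cq : {for z, continuous (fun z : I * I => psi z.1)}.
    exact: (comp_continuous fst_continuous cpsi).
  apply: cvgD; first exact: cp.
  apply: cvgM; last by apply: cvgB; [exact: cq|exact: cp].
  exact: (comp_continuous snd_continuous ival_continuous).
- by rewrite ival0 mul0r addr0 pE.
- by rewrite ival1 mul1r addrC subrK qE.
- by rewrite phi0 subrr mulr0 addr0 -phi0 -pE path_zero.
- by rewrite phi1 subrr mulr0 addr0 -phi1 -pE path_one.
Qed.

Lemma const_concat_homotopic {x y : X} (p : upath R x y) :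
  path_homotopic (concat_path (const_path x) p) p.
Proof.
apply: (@reparametrization_homotopic _ _ _ _ p _ _
  (fun t => Num.max 0 (2 * ival t + -1)) ival) => [||||t|t].
- apply: maxr_continuous; first exact: constant_continuous.
  exact/affine_real_continuous/ival_continuous.
- exact: ival_continuous.
- by rewrite ival0 max_l //; lra.
- by rewrite ival1 max_r //; lra.
- rewrite concat_pathE /concat_fun; case: ifPn => h.
    by rewrite max_l ?clamp0 ?path_zero //; lra.
  by rewrite max_r //; lra.
- by rewrite clampK.
Qed.

Lemma concat_const_homotopic {x y : X} (p : upath R x y) :
  path_homotopic (concat_path p (const_path y)) p.
Proof.
apply: (@reparametrization_homotopic _ _ _ _ p _ _
  (fun t => Num.min 1 (2 * ival t + 0)) ival) => [||||t|t].
- apply: minr_continuous; first exact: constant_continuous.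
  exact/affine_real_continuous/ival_continuous.
- exact: ival_continuous.
- by rewrite ival0 min_r //; lra.
- by rewrite ival1 min_l //; lra.
- rewrite concat_pathE /concat_fun addr0; case: ifPn => h.
    by rewrite min_r //; lra.
  by rewrite min_l ?clamp1 ?path_one //; lra.
- by rewrite clampK.
Qed.

Lemma concat_inv_homotopic {x y : X} (p : upath R x y) :
  path_homotopic (concat_path p (inv_path p)) (const_path x).
Proof.
apply: (@reparametrization_homotopic _ _ _ _ p _ _
  (fun t => Num.min (2 * ival t + 0) (- 2 * ival t + 2)) (fun=> 0))
  => [||||t|t].
- apply: minr_continuous; exact/affine_real_continuous/ival_continuous.
- exact: constant_continuous.
- by rewrite ival0 min_l //; lra.
- by rewrite ival1 min_r //; lra.
- have := ival_itv t; rewrite concat_pathE /concat_fun => /andP[t0 t1].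
  case: ifPn => h; first by rewrite min_l ?addr0 //; lra.
  rewrite min_r; last by lra.
  rewrite inv_pathE /inv_fun clampE; last by apply/andP; split; lra.
  by congr (p (clamp _)); lra.
- by rewrite clamp0 path_zero.
Qed.

Lemma inv_concat_homotopic {x y : X} (p : upath R x y) :
  path_homotopic (concat_path (inv_path p) p) (const_path y).
Proof.
apply: (@reparametrization_homotopic _ _ _ _ p _ _
  (fun t => Num.max (- 2 * ival t + 1) (2 * ival t + - 1)) (fun=> 1))
  => [||||t|t].
- apply: maxr_continuous; exact/affine_real_continuous/ival_continuous.
- exact: constant_continuous.
- by rewrite ival0 max_l //; lra.
- by rewrite ival1 max_r //; lra.
- have := ival_itv t; rewrite concat_pathE /concat_fun => /andP[t0 t1].
  case: ifPn => h; last by rewrite max_r //; lra.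
  rewrite max_l; last by lra.
  rewrite inv_pathE /inv_fun clampE; last by apply/andP; split; lra.
  by congr (p (clamp _)); lra.
- by rewrite clamp1 path_one.
Qed.

Lemma concat_assoc_homotopic {w x y z : X} (p : upath R w x)
    (q : upath R x y) (r : upath R y z) :
  path_homotopic (concat_path (concat_path p q) r)
    (concat_path p (concat_path q r)).
Proof.
apply: (@reparametrization_homotopic _ _ _ _
  (concat_path p (concat_path q r)) _ _
  (fun t => Num.min (2 * ival t + 0)
    (Num.min (1 * ival t + 4^-1) (2^-1 * ival t + 2^-1))) ival)
  => [||||t|t].
- apply: minr_continuous.
    exact/affine_real_continuous/ival_continuous.
  apply: minr_continuous; exact/affine_real_continuous/ival_continuous.
- exact: ival_continuous.
- rewrite ival0; case: (leP (1 * _ + 4^-1)) => ?; case: leP => ?; lra.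
- rewrite ival1; case: (leP (1 * _ + 4^-1)) => ?; case: leP => ?; lra.
- have := ival_itv t; set u := ival t => /andP[t0 t1].
  set m := Num.min _ _.
  have [hu|hu] := leP u 4^-1.
    have mE : m = 2 * u.
      rewrite /m; case: (leP (1 * _ + 4^-1)) => ?; case: leP => ?; lra.
    rewrite !concat_pathE /concat_fun -/u ifT; last by lra.
    rewrite mE clampE; last by apply/andP; split; lra.
    by rewrite !ifT //; lra.
  have [hv|hv] := leP u 2^-1.
    have mE : m = u + 4^-1.
      rewrite /m; case: (leP (1 * _ + 4^-1)) => ?; case: leP => ?; lra.
    rewrite !concat_pathE /concat_fun -/u ifT; last by lra.
    rewrite mE clampE; last by apply/andP; split; lra.
    rewrite ifF; last by apply/negbTE; rewrite -ltNge; lra.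
    rewrite clampE; last by apply/andP; split; lra.
    rewrite ifF; last by apply/negbTE; rewrite -ltNge; lra.
    rewrite clampE; last by apply/andP; split; lra.
    rewrite ifT; last by lra.
    by congr (q (clamp _)); lra.
  have mE : m = 2^-1 * u + 2^-1.
    rewrite /m; case: (leP (1 * _ + 4^-1)) => ?; case: leP => ?; lra.
  rewrite !concat_pathE /concat_fun -/u ifF; last first.
    by apply/negbTE; rewrite -ltNge; lra.
  rewrite mE clampE; last by apply/andP; split; lra.
  rewrite ifF; last by apply/negbTE; rewrite -ltNge; lra.
  rewrite clampE; last by apply/andP; split; lra.
  rewrite ifF; last by apply/negbTE; rewrite -ltNge; lra.
  by congr (r (clamp _)); lra.
- by rewrite clampK.
Qed.

End path_operations.

Section fundamental_group.
Context (R : realType) {X : topologicalType} (x : X).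

Definition loop_homotopic_rel (p q : upath R x x) : bool :=
  `[< path_homotopic p q >].

Lemma loop_homotopic_refl : reflexive loop_homotopic_rel.
Proof. by move=> p; apply/asboolP; exact: path_homotopic_refl. Qed.

Lemma loop_homotopic_sym : symmetric loop_homotopic_rel.
Proof. by move=> p q; apply/asboolP/asboolP; exact: path_homotopic_sym. Qed.

Lemma loop_homotopic_trans : transitive loop_homotopic_rel.
Proof.
move=> q p r /asboolP pq /asboolP qr; apply/asboolP.
exact: path_homotopic_trans pq qr.
Qed.

Definition loop_homotopic : equiv_rel (upath R x x) :=
  EquivRel loop_homotopic_rel loop_homotopic_refl loop_homotopic_sym
    loop_homotopic_trans.

(* The loop space [upath R x x] carries the compact-open topology, so this
   type carries the topology of pi_1^qtop(X, x). *)
Definition fundamental_group : Type := {eq_quot loop_homotopic}.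

HB.instance Definition _ :=
  Topological.copy fundamental_group
    (quotient_topology {eq_quot loop_homotopic}).
HB.instance Definition _ := Quotient.on fundamental_group.

Definition loop_class (p : upath R x x) : fundamental_group :=
  \pi_fundamental_group p.

Lemma loop_classP (p q : upath R x x) :
  loop_class p = loop_class q <-> path_homotopic p q.
Proof. by split=> [/eqmodP/asboolP|h]; last exact/eqmodP/asboolP. Qed.

Lemma loop_class_repr (a : fundamental_group) : loop_class (repr a) = a.
Proof. exact: reprK. Qed.

Lemma repr_loop_class (p : upath R x x) :
  path_homotopic (repr (loop_class p)) p.
Proof. by apply/loop_classP; rewrite loop_class_repr. Qed.

Definition pi1_one : fundamental_group := loop_class (const_path x).

Definition pi1_inv (a : fundamental_group) : fundamental_group :=
  loop_class (inv_path (repr a)).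

Definition pi1_mul (a b : fundamental_group) : fundamental_group :=
  loop_class (concat_path (repr a) (repr b)).

Lemma pi1_mul_class (p q : upath R x x) :
  pi1_mul (loop_class p) (loop_class q) = loop_class (concat_path p q).
Proof.
by apply/loop_classP; apply: concat_path_homotopic; exact: repr_loop_class.
Qed.

Lemma pi1_inv_class (p : upath R x x) :
  pi1_inv (loop_class p) = loop_class (inv_path p).
Proof. by apply/loop_classP/inv_path_homotopic/repr_loop_class. Qed.

Lemma pi1_mulA : associative pi1_mul.
Proof.
move=> a b c; rewrite -[a]loop_class_repr -[b]loop_class_repr.
rewrite -[c]loop_class_repr !pi1_mul_class; apply/esym/loop_classP.
exact: concat_assoc_homotopic.
Qed.

Lemma pi1_mul1g : left_id pi1_one pi1_mul.
Proof.
move=> a; rewrite -[a]loop_class_repr pi1_mul_class; apply/loop_classP.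
exact: const_concat_homotopic.
Qed.

Lemma pi1_mulg1 : right_id pi1_one pi1_mul.
Proof.
move=> a; rewrite -[a]loop_class_repr pi1_mul_class; apply/loop_classP.
exact: concat_const_homotopic.
Qed.

Lemma pi1_mulVg : left_inverse pi1_one pi1_inv pi1_mul.
Proof.
move=> a; rewrite -[a]loop_class_repr pi1_inv_class pi1_mul_class.
exact/loop_classP/inv_concat_homotopic.
Qed.

Lemma pi1_mulgV : right_inverse pi1_one pi1_inv pi1_mul.
Proof.
move=> a; rewrite -[a]loop_class_repr pi1_inv_class pi1_mul_class.
exact/loop_classP/concat_inv_homotopic.
Qed.

HB.instance Definition _ := isGroup.Build fundamental_group
  pi1_mulA pi1_mul1g pi1_mulg1 pi1_mulVg pi1_mulgV.

End fundamental_group.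

Section locally_path_connected.
Context (R : realType) (X : topologicalType).

Definition path_connected (W : set X) : Prop :=
  forall a b, W a -> W b -> exists p : upath R a b, range p `<=` W.

Definition locally_path_connected : Prop :=
  forall (a : X) (U : set X), nbhs a U ->
    exists W : set X, [/\ open W, W a, W `<=` U & path_connected W].

End locally_path_connected.

Section path_spanier.
Context (R : realType) {X : topologicalType} (x : X).

(* P(X, x): a path starting at x is stored with its endpoint. *)
Definition paths_from : Type := {y : X & upath R x y}.

Record path_open_cover := PathOpenCover {
  cover_set :> paths_from -> set X;
  cover_open : forall u, open (cover_set u);
  cover_covers : \bigcup_u cover_set u = [set: X];
  cover_endpoint : forall u : paths_from, cover_set u (projT2 u one)
}.

Definition lasso (u : paths_from) (v : upath R (projT1 u) (projT1 u)) :
    upath R x x :=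
  concat_path (concat_path (projT2 u) v) (inv_path (projT2 u)).

(* The product of loops is iterated concatenation, ending with a constant loop
   (which is the product when n = 0); the homotopy class is unaffected. *)
Definition path_spanier (V : path_open_cover) : set (fundamental_group R x) :=
  [set a | exists (n : nat) (u : 'I_n -> paths_from)
      (v : forall j, upath R (projT1 (u j)) (projT1 (u j))),
    (forall j, range (v j) `<=` V (u j)) /\
    a = loop_class
          (\big[@concat_path R X x x x / const_path x]_(j < n) lasso (v j))].

End path_spanier.

(* Main.v *)
(** Fix a loop [f] whose class lies in the path Spanier group [H].  Say that [t]
    is good if, for every neighbourhood [O] of [f t] and every loop [g] close
    enough to [f], some path [h] in [O] from [f t] to [g t] makes the class of
    [f|[0,t] * h * (g|[0,t])^-1] lie in [H].  The point 0 is good.  Goodness is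
    locally constant: if [f] maps a neighbourhood [J] of [t] into the set
    [V_u] attached to [u = f|[0,t]], then moving from [s] to [s'] inside [J]
    multiplies the above class by a lasso on [u] whose loop follows [f] from
    [s] to [s'], crosses to [g], and returns along [g], all inside [V_u]; local
    path connectedness provides the crossing.  So 1 is good, and taking
    [O = V_f] gives [f h g^-1] in [H] with [f h f^-1] a lasso, whence [g] is
    in [H]. *)

Require Import Defs.
From mathcomp Require Import all_boot all_order all_algebra.
From mathcomp Require Import all_classical all_reals all_analysis homotopy.
From mathcomp Require Import lra.
From Corelib Require Setoid.

Set Implicit Arguments.
Unset Strict Implicit.
Unset Printing Implicit Defensive.

Import Order.TTheory GRing.Theory Num.Theory.
Import numFieldNormedType.Exports.

Local Open Scope classical_set_scope.
Local Open Scope ring_scope.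

(** * Rewriting up to path homotopy *)

#[local] Instance path_homotopic_equivalence (R : realType)
  (X : topologicalType) (x y : X) :
    RelationClasses.Equivalence (@path_homotopic R X x y).
Proof.
split; [exact: path_homotopic_refl|exact: path_homotopic_sym|].
exact: path_homotopic_trans.
Qed.

#[local] Instance concat_path_proper (R : realType) (X : topologicalType)
  (x y z : X) : Morphisms.Proper
    (Morphisms.respectful (@path_homotopic R X x y)
      (Morphisms.respectful (@path_homotopic R X y z)
        (@path_homotopic R X x z))) (@concat_path R X x y z).
Proof. by move=> p p' pp q q' qq; exact: concat_path_homotopic. Qed.

#[local] Instance inv_path_proper (R : realType) (X : topologicalType)
  (x y : X) : Morphisms.Proper
    (Morphisms.respectful (@path_homotopic R X x y) (@path_homotopic R X y x))
    (@inv_path R X x y).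
Proof. by move=> p p'; exact: inv_path_homotopic. Qed.

#[local] Hint Resolve path_homotopic_refl : core.

(** * Groupoid calculus of paths *)

Section groupoid.
Context {R : realType} {X : topologicalType}.

Local Notation "p ~ q" := (path_homotopic p q) (at level 70).
Local Notation "p ** q" := (concat_path p q) (at level 40, left associativity).

Lemma concat_invK {x y z : X} (p : upath R x y) (q : upath R x z) :
  p ** (inv_path p ** q) ~ q.
Proof.
by rewrite -concat_assoc_homotopic concat_inv_homotopic const_concat_homotopic.
Qed.

Lemma concat_Kinv {x y z : X} (p : upath R x y) (q : upath R y z) :
  inv_path p ** (p ** q) ~ q.
Proof.
by rewrite -concat_assoc_homotopic inv_concat_homotopic const_concat_homotopic.
Qed.

Lemma inv_path_unique {x y : X} (p : upath R x y) (q : upath R y x) :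
  p ** q ~ const_path x -> inv_path p ~ q.
Proof.
move=> pq1; rewrite -[inv_path p]concat_const_homotopic -pq1.
exact: concat_Kinv.
Qed.

Lemma inv_pathK {x y : X} (p : upath R x y) : inv_path (inv_path p) ~ p.
Proof. by apply: inv_path_unique; exact: inv_concat_homotopic. Qed.

Lemma inv_concat {x y z : X} (p : upath R x y) (q : upath R y z) :
  inv_path (p ** q) ~ inv_path q ** inv_path p.
Proof.
apply: inv_path_unique.
by rewrite concat_assoc_homotopic concat_invK concat_inv_homotopic.
Qed.

(** The cancellation that moves goodness from [s] to [s']: [a], [b], [c] are the arcs of [f] from 0
    to [t], [t] to [s], [s] to [s']; [k], [e] are the arcs of [g] from 0 to [s], [s] to [s']; [h]
    and [d] cross from [f] to [g] at [s] and at [s']. *)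
Lemma concat_lasso_homotopic {w x y z y' z' : X} (a : upath R w x)
    (b : upath R x y) (c : upath R y z) (d : upath R z z')
    (e : upath R y' z') (h : upath R y y') (k : upath R w y') :
  a ** (b ** (c ** (d ** (inv_path e ** (inv_path h ** inv_path b)))))
    ** inv_path a ** (a ** b ** h ** inv_path k)
  ~ a ** b ** c ** d ** inv_path (k ** e).
Proof.
by rewrite inv_concat !concat_assoc_homotopic !concat_Kinv.
Qed.

Lemma range_concat_path {x y z : X} (p : upath R x y) (q : upath R y z)
    (A : set X) :
  range p `<=` A -> range q `<=` A -> range (p ** q) `<=` A.
Proof.
move=> pA qA _ [t _ <-]; rewrite concat_pathE /concat_fun.
by case: ifP => _; [apply: pA|apply: qA]; exact: imageT.
Qed.

Lemma range_inv_path {x y : X} (p : upath R x y) (A : set X) :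
  range p `<=` A -> range (inv_path p) `<=` A.
Proof. by move=> pA _ [t _ <-]; apply: pA; exact: imageT. Qed.

End groupoid.

(** * Arcs of a path and their neighbourhoods *)

Section arcs.
Context {R : realType} {X : topologicalType}.
Local Notation I := (unit_interval R).
Local Notation "p ~ q" := (path_homotopic p q) (at level 70).

(** The order of [s] and [t] is free: for [t] below [s] the arc runs backwards. *)
Definition arc_fun (f : I -> X) (s t r : I) : X :=
  f (clamp (ival s + ival r * (ival t - ival s))).

Lemma arc_fun_continuous (f : I -> X) (s t : I) :
  continuous f -> continuous (arc_fun f s t).
Proof.
move=> cf; apply: (comp_continuous _ cf).
have := @affine_continuous R I ival (ival t - ival s) (ival s) ival_continuous.
by under eq_fun do rewrite mulrC addrC.
Qed.

Lemma arc_fun_zero (f : I -> X) (s t : I) (y : X) :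
  f s = y -> arc_fun f s t zero = y.
Proof. by rewrite /arc_fun ival0 mul0r addr0 clampK. Qed.

Lemma arc_fun_one (f : I -> X) (s t : I) (z : X) :
  f t = z -> arc_fun f s t one = z.
Proof. by rewrite /arc_fun ival1 mul1r addrC subrK clampK. Qed.

Definition arc {a b : X} (f : upath R a b) {s t : I} {y z : X}
    (fs : f s = y) (ft : f t = z) : upath R y z :=
  mk_path (@arc_fun_continuous f s t (@cts_fun _ _ f))
    (@arc_fun_zero f s t y fs) (@arc_fun_one f s t z ft).
#[global] Arguments arc {a b} f {s t y z} fs ft.

Lemma arcE {a b : X} (f : upath R a b) {s t : I} {y z : X}
    (fs : f s = y) (ft : f t = z) :
  arc f fs ft = arc_fun f s t :> (I -> X).
Proof. by []. Qed.

Lemma range_arc {a b : X} (f : upath R a b) {s t : I} {y z : X}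
    (fs : f s = y) (ft : f t = z) (A : set X) :
  (forall r : R, 0 <= r <= 1 ->
    A (f (clamp (ival s + r * (ival t - ival s))))) ->
  range (arc f fs ft) `<=` A.
Proof.
by move=> fA _ [r _ <-]; rewrite arcE /arc_fun; apply: fA; exact: ival_itv.
Qed.

Lemma arc_id {a b : X} (f : upath R a b) : arc f path_zero path_one = f.
Proof.
apply/path_eqP => r.
by rewrite arcE /arc_fun ival0 ival1 add0r subr0 mulr1 clampK.
Qed.

Lemma arc_const {a b : X} (f : upath R a b) {s : I} {y : X} (fs : f s = y) :
  arc f fs fs = const_path y.
Proof.
by apply/path_eqP => r; rewrite arcE /arc_fun subrr mulr0 addr0 clampK.
Qed.

(** Both sides reparametrize [f], one by a piecewise affine map and one by an affine map with the
    same end values. *)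
Lemma concat_arc {a b : X} (f : upath R a b) {s t u : I} {y z w : X}
    (fs : f s = y) (ft : f t = z) (fu : f u = w) :
  concat_path (arc f fs ft) (arc f ft fu) ~ arc f fs fu.
Proof.
pose lin (c d r : R) := c + r * (d - c).
have clin c d (h : I -> R) : continuous h ->
    continuous (fun r => lin c d (h r)).
  move=> ch; have := @affine_real_continuous R I h (d - c) c ch.
  by under eq_fun do rewrite mulrC addrC.
apply: (@reparametrization_homotopic _ _ _ _ _ _ f _ _
  (fun r => if ival r <= 2^-1 then lin (ival s) (ival t) (2 * ival r)
            else lin (ival t) (ival u) (2 * ival r - 1))
  (fun r => lin (ival s) (ival u) (ival r))) => [||||r|r].
- apply: (if_le_continuous ival_continuous) => [||r ->].
  + apply: clin; have := @affine_real_continuous R I ival 2 0 ival_continuous.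
    by under eq_fun do rewrite addr0.
  + by apply: clin; exact/affine_real_continuous/ival_continuous.
  + by rewrite /lin; lra.
- exact/clin/ival_continuous.
- by rewrite ival0 ifT /lin; lra.
- rewrite ival1 ifF /lin; last by apply/negbTE; rewrite -ltNge; lra.
  lra.
- have /andP[r0 r1] := ival_itv r.
  rewrite concat_pathE /concat_fun !arcE /arc_fun; case: ifPn => h.
    by rewrite clampE //; apply/andP; split; lra.
  by rewrite clampE //; apply/andP; split; lra.
- by rewrite arcE.
Qed.

#[global] Arguments concat_arc {a b} f {s t u y z w} fs ft fu.

(** The parameters between [s] and [t] form a compact set, the image of [[0, 1]] under [l], so this
    is a subbasic condition of the compact-open topology. *)
Lemma nbhs_image_arc {a b : X} (f : upath R a b) (s t : I) (O : set X) :
  open O ->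
  (forall r : R, 0 <= r <= 1 ->
    O (f (clamp (ival s + r * (ival t - ival s))))) ->
  nbhs f [set g : upath R a b | forall r : R, 0 <= r <= 1 ->
    O (g (clamp (ival s + r * (ival t - ival s))))].
Proof.
move=> oO fO.
pose l (r : R) : I := clamp (ival s + r * (ival t - ival s)).
have cl : continuous l.
  have := @affine_continuous R R id (ival t - ival s) (ival s) (fun=> cvg_id).
  by under eq_fun do rewrite mulrC addrC.
have cK : compact (l @` `[0, 1]).
  apply: continuous_compact; last exact: segment_compact.
  exact: continuous_subspaceT.
have oN : open [set g : upath R a b | g @` (l @` `[0, 1]) `<=` O].
  (* Open sets of paths are traces of compact-open sets of functions. *)
  by exists [set g : {compact-open, I -> X} | g @` (l @` `[0, 1]) `<=` O] => //;
    exact: compact_open_open.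
have : nbhs f [set g : upath R a b | g @` (l @` `[0, 1]) `<=` O].
  apply: open_nbhs_nbhs; split => // _ [_ [r r01 <-] <-]; apply: fO.
  by move: r01; rewrite /= in_itv.
apply: filterS => g gO r r01; apply: gO.
by exists (l r) => //; exists r => //; rewrite /= in_itv.
Qed.

Lemma nbhs_eval {a b : X} (f : upath R a b) (t : I) (O : set X) :
  open O -> O (f t) -> nbhs f [set g : upath R a b | O (g t)].
Proof.
(* A point is the degenerate arc from [t] to [t]. *)
move=> oO fO; have lt (r : R) : clamp (ival t + r * (ival t - ival t)) = t.
  by rewrite subrr mulr0 addr0 clampK.
apply: filterS (@nbhs_image_arc _ _ f t t O oO _) => [g /(_ 0)|r _].
  by rewrite lt lexx ler01; apply.
by rewrite lt.
Qed.

End arcs.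

(** * Connectedness and neighbourhoods in the unit interval *)

Lemma connected_locally_constant (T : topologicalType) (P : T -> Prop) :
  connected [set: T] -> (forall t, \forall s \near t, P s <-> P t) ->
  forall a b, P a -> P b.
Proof.
move=> cT lcP a b Pa; suff -> : P = [set: T] by [].
apply: cT; first by exists a.
- exists P; last by rewrite setTI.
  rewrite openE => t Pt; apply: filterS (lcP t) => s [_]; exact.
- exists P; last by rewrite setTI.
  rewrite -openC openE => t nPt; apply: filterS (lcP t) => s [+ _].
  by move=> /contra_not; exact.
Qed.

Lemma unit_interval_connected (R : realType) : connected [set: unit_interval R].
Proof.
have -> : [set: unit_interval R] = clamp @` [set: R].
  by apply/seteqP; split=> // t _; exists (ival t); rewrite // clampK.
apply: connected_continuous_connected; first exact/connected_intervalP.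
exact/continuous_subspaceT/clamp_continuous.
Qed.

(** Continuity of [clamp] at [ival t] gives a ball in [R] itself, so [r] may leave [[0, 1]]. *)
Lemma nbhs_unit_interval (R : realType) (t : unit_interval R)
    (A : set (unit_interval R)) :
  nbhs t A -> exists2 e : R, 0 < e &
    forall r, `|r - ival t| < e -> A (clamp r).
Proof.
rewrite -[t in nbhs t]clampK => /clamp_continuous /nbhs_ballP[e e0 eA].
by exists e => // r re; apply: eA; rewrite /ball /= distrC.
Qed.

Lemma nbhs_ival_ball (R : realType) (t : unit_interval R) (e : R) :
  0 < e -> nbhs t [set s | `|ival s - ival t| < e].
Proof.
move=> e0; have : nbhs t (ival @^-1` ball (ival t) e).
  exact/ival_continuous/nbhsx_ballx.
by apply: filterS => s; rewrite /ball /= distrC.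
Qed.

(** * The path Spanier group is a subgroup *)

Section path_spanier_group.
Context {R : realType} {X : topologicalType} {x : X} (V : path_open_cover R x).
Local Open Scope group_scope.

(** With lists of lassos in place of families over ['I_n], products become list concatenation and
    inverses an induction. *)
Lemma path_spanierP (a : fundamental_group R x) :
  path_spanier V a <->
  exists s : seq {u : paths_from R x & {v : upath R (projT1 u) (projT1 u) |
    range v `<=` V u}},
  a = \prod_(w <- s) loop_class (lasso (sval (projT2 w))).
Proof.
have E (I : Type) (s : seq I) (F : I -> upath R x x) :
    loop_class (\big[@concat_path R X x x x / const_path x]_(i <- s) F i)
    = \prod_(i <- s) loop_class (F i).
  by apply: big_morph => // p q; rewrite -pi1_mul_class.
split.
  case=> n [u [v [vV ->]]].
  exists [seq existT _ (u j) (exist _ (v j) (vV j)) | j <- index_enum 'I_n].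
  by rewrite big_map E.
case=> s ->; pose w j := tnth (in_tuple s) j.
exists (size s), (fun j => projT1 (w j)), (fun j => sval (projT2 (w j))).
by split=> [j|]; [exact: (svalP (projT2 (w j)))|rewrite E big_tnth].
Qed.

Lemma path_spanier_lasso (u : paths_from R x)
    (v : upath R (projT1 u) (projT1 u)) :
  range v `<=` V u -> path_spanier V (loop_class (lasso v)).
Proof.
move=> vV; apply/path_spanierP.
by exists [:: existT _ u (exist _ v vV)]; rewrite big_seq1.
Qed.

Lemma path_spanier_one : path_spanier V 1.
Proof. by apply/path_spanierP; exists [::]; rewrite big_nil. Qed.

Lemma path_spanier_mul (a b : fundamental_group R x) :
  path_spanier V a -> path_spanier V b -> path_spanier V (a * b).
Proof.
move=> /path_spanierP[s ->] /path_spanierP[t ->]; apply/path_spanierP.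
by exists (s ++ t); rewrite big_cat.
Qed.

(** The inverse of a lasso is the lasso on the same path with its loop reversed, which has the same
    range. *)
Lemma path_spanier_inv (a : fundamental_group R x) :
  path_spanier V a -> path_spanier V a^-1.
Proof.
case/path_spanierP=> s ->; elim: s => [|[u [v vV]] s IHs].
  by rewrite big_nil invg1; exact: path_spanier_one.
rewrite big_cons invgM; apply: path_spanier_mul => //=.
rewrite -[_^-1]/(pi1_inv _) pi1_inv_class.
suff /loop_classP -> : path_homotopic (inv_path (lasso v)) (lasso (inv_path v)).
  by apply: path_spanier_lasso; exact: range_inv_path.
by rewrite /lasso !inv_concat inv_pathK concat_assoc_homotopic.
Qed.

Lemma path_spanier_group_closed : group_closed [in path_spanier V].
Proof.
split; first by rewrite inE; exact: path_spanier_one.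
move=> a b; rewrite !inE => Va Vb.
exact/path_spanier_mul/path_spanier_inv.
Qed.

(** * Good parameters of a loop *)

Local Notation I := (unit_interval R).

(* The endpoints [y] and [z] are variables because [f one = x] is not
   definitional. *)
Definition spanier_near (f : upath R x x) (t : I) : Prop :=
  forall (y : X) (fy : f t = y) (O : set X), open O -> O y ->
  nbhs f [set g : upath R x x | forall (z : X) (gz : g t = z),
    exists2 h : upath R y z, range h `<=` O &
      path_spanier V (loop_class (concat_path
        (concat_path (arc f path_zero fy) h) (inv_path (arc g path_zero gz))))].

Lemma spanier_near_zero (f : upath R x x) : spanier_near f zero.
Proof.
move=> y fy O oO Oy; have yx : y = x by rewrite -fy path_zero.
move: fy Oy; rewrite {y}yx => fx Ox.
apply: (@nearW _ (nbhs f)) => g z gz; have zx : z = x by rewrite -gz path_zero.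
move: gz; rewrite {z}zx => gx; exists (const_path x).
  by move=> _ [t _ <-].
(* Both arcs now run from 0 to 0 with the same proof at each end, hence are constant. *)
have -> : fx = path_zero by exact: Prop_irrelevance.
have -> : gx = path_zero by exact: Prop_irrelevance.
rewrite !arc_const.
suff /loop_classP -> : @path_homotopic R _ _ _ (concat_path
    (concat_path (const_path x) (const_path x)) (inv_path (const_path x)))
    (const_path x).
  exact: path_spanier_one.
by rewrite const_concat_homotopic concat_inv_homotopic.
Qed.

(** The hypotheses are symmetric in [s] and [s'], so one implication yields both directions of local
    constancy. *)
Lemma spanier_near_step (f : upath R x x) (t s s' : I) (e : R) :
  locally_path_connected R X ->
  (forall r : R, (`|r - ival t| < e)%R ->
    V (existT _ (f t) (arc f path_zero erefl)) (f (clamp r))) ->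
  (`|ival s - ival t| < e)%R -> (`|ival s' - ival t| < e)%R ->
  spanier_near f s -> spanier_near f s'.
Proof.
set u := existT _ _ _ => hX fV ts ts' Ps y fy O oO Oy.
(* Convexity of the ball of radius [e] around [ival t]. *)
have fVs (a b : I) (r : R) : (`|ival a - ival t| < e)%R ->
    (`|ival b - ival t| < e)%R -> (0 <= r <= 1)%R ->
    V u (f (clamp (ival a + r * (ival b - ival a))%R)).
  rewrite !ltr_norml => /andP[a1 a2] /andP[b1 b2] /andP[r0 r1]; apply: fV.
  rewrite ltr_norml; apply/andP.
  have [ab|/ltW ab] := leP (ival a) (ival b).
    have : (0 <= r * (ival b - ival a) <= ival b - ival a)%R.
      by apply/andP; split; nra.
    by case/andP=> ? ?; split; lra.
  have : (ival b - ival a <= r * (ival b - ival a) <= 0)%R.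
    by apply/andP; split; nra.
  by case/andP=> ? ?; split; lra.
have Vy : V u y by rewrite -fy -[s']clampK; exact: fV.
(* The crossing at [s'] must lie in [O] for the conclusion and in [V u] for the lasso. *)
have [W [oW Wy WOV Wpc]] : exists W : set X,
    [/\ open W, W y, W `<=` O `&` V u & path_connected R W].
  apply: hX; apply: filterI; apply: open_nbhs_nbhs; split => //.
  exact: cover_open.
have Vs : V u (f s) by rewrite -[s]clampK; exact: fV.
(* Three conditions on [g]: the crossing [h] at [s] stays in [V u], [g] maps the parameters between
   [s] and [s'] into [V u], and [g s'] lies in [W]. *)
have g1 := Ps _ erefl _ (cover_open V u) Vs.
have g2 := nbhs_image_arc (cover_open V u) (fun r => fVs _ _ r ts ts').
have g3 : nbhs f [set g : upath R x x | W (g s')].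
  by apply: nbhs_eval => //; rewrite fy.
apply: filterS3 g1 g2 g3 => g g1 g2 /= g3 z gz.
have [h hV hS] := g1 _ erefl.
have [d dW] := Wpc y z Wy (eq_ind _ W g3 _ gz).
exists d; first by move=> w /dW/WOV[].
pose b := arc f (erefl (f t)) (erefl (f s)).
pose c := arc f (erefl (f s)) fy.
pose k := arc g (erefl (g s)) gz.
(* Along [f] from [t] through [s] to [s'], across [d], back along [g] to [s], back across [h], then
   along [f] to [t]. *)
pose v := concat_path b (concat_path c (concat_path d (concat_path (inv_path k)
  (concat_path (inv_path h) (inv_path b))))).
have tt : (`|ival t - ival t| < e)%R.
  by rewrite subrr normr0; exact: le_lt_trans ts.
have bV : range b `<=` V u by apply: range_arc => r; exact: fVs.
have vV : range v `<=` V u.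
  apply: range_concat_path => //.
  apply: range_concat_path; first by apply: range_arc => r; exact: fVs.
  apply: range_concat_path; first by move=> w /dW/WOV[].
  apply: range_concat_path; first by apply: range_inv_path; exact: range_arc.
  by apply: range_concat_path; exact: range_inv_path.
(* The class at [s'] is the lasso of [v] times the class at [s]. *)
have /loop_classP -> : path_homotopic
    (concat_path (concat_path (arc f path_zero fy) d)
      (inv_path (arc g path_zero gz)))
    (concat_path (@lasso R X x u v)
      (concat_path (concat_path (arc f path_zero (erefl (f s))) h)
        (inv_path (arc g path_zero (erefl (g s)))))).
  rewrite -(concat_arc g path_zero (erefl (g s)) gz).
  rewrite -(concat_arc f path_zero (erefl (f s)) fy).
  rewrite -(concat_arc f path_zero (erefl (f t)) (erefl (f s))).
  by rewrite concat_lasso_homotopic.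
rewrite -pi1_mul_class; apply: path_spanier_mul => //.
exact: path_spanier_lasso.
Qed.

Lemma spanier_near_locally_constant (f : upath R x x) :
  locally_path_connected R X ->
  forall t, \forall s \near t, spanier_near f s <-> spanier_near f t.
Proof.
move=> hX t; pose u : paths_from R x := existT _ (f t) (arc f path_zero erefl).
have fV : nbhs t (f @^-1` V u).
  apply: (@cts_fun _ _ f); apply: open_nbhs_nbhs; split.
    exact: cover_open.
  by have := cover_endpoint V u; rewrite path_one.
have [e e0 eV] := nbhs_unit_interval fV.
apply: filterS (nbhs_ival_ball t e0) => s /= ts.
have tt : (`|ival t - ival t| < e)%R by rewrite subrr normr0.
by split; exact: spanier_near_step eV _ _.
Qed.

Lemma path_spanier_open : locally_path_connected R X -> open (path_spanier V).
Proof.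
move=> hX.
(* This is the definition of openness in the quotient topology. *)
suff : open (@loop_class R X x @^-1` path_spanier V) by [].
rewrite openE => f Vf.
have P1 : spanier_near f one.
  apply: connected_locally_constant (@spanier_near_zero f).
    exact: unit_interval_connected.
  exact: spanier_near_locally_constant.
pose u : paths_from R x := existT _ x f.
have Vx : V u x by have := cover_endpoint V u; rewrite path_one.
apply: filterS (P1 x path_one _ (cover_open V u) Vx) => g /(_ x path_one)[h hV].
rewrite !arc_id /preimage /= => fhgS.
have lV : path_spanier V (loop_class (@lasso R X x u h)).
  exact: path_spanier_lasso.
(* That is, [g = (f h g^-1)^-1 (f h f^-1) f], where all three factors have their class in the
   subgroup. *)
have /loop_classP -> : path_homotopic g (concat_path
    (inv_path (concat_path (concat_path f h) (inv_path g)))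
    (concat_path (@lasso R X x u h) f)).
  rewrite /lasso /= !inv_concat inv_pathK !concat_assoc_homotopic.
  by rewrite inv_concat_homotopic concat_const_homotopic concat_Kinv
    inv_concat_homotopic concat_const_homotopic.
rewrite -pi1_mul_class -pi1_inv_class; apply: path_spanier_mul.
  exact: path_spanier_inv.
by rewrite -pi1_mul_class; exact: path_spanier_mul.
Qed.

End path_spanier_group.

Theorem theorem3p2 (R : realType) (X : topologicalType) (x : X)
    (hX : locally_path_connected R X) (V : path_open_cover R x) :
  group_closed [in path_spanier V] /\ open (path_spanier V).
Proof.
by split; [exact: path_spanier_group_closed|exact: path_spanier_open].
Qed.
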